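(* Let $\alpha$ be a cardinal and let $\mathcal{C}$ be a class of topological spaces that is closed under formation of coproducts of families of fewer than $\alpha$ spaces. Consider the restriction of $\leq_2$ to functions whose domain and codomain belong to $\mathcal{C}$. Then the partial order induced on the equivalence classes of such functions is an $\alpha$-complete join-semilattice.
   Context: A partial function $F:\subseteq X\to Y$ is a function from a subset $\operatorname{dom}(F)\subseteq X$ to $Y$; it is continuous if continuous on $\operatorname{dom}(F)$ with the subspace topology. For functions $f:\underline{X}_1\to\underline{Y}_1$, $g:\underline{X}_2\to\underline{Y}_2$ between topological spaces, $f\leq_2 g$ means there are continuous partial functions $F:\subseteq\underline{X}_1\times\underline{Y}_2\to\underline{Y}_1$ (product topology) and $G:\subseteq\underline{X}_1\to\underline{X}_2$ with $f(x)=F(x,g(G(x)))$ (all terms defined) for every $x\in X_1$. The coproduct $\coprod_{i\in I}\underline{X}_i$ is $\bigcup_{i\in I}\{i\}\times X_i$ with the smallest topology containing all $\{i\}\times U$, $U$ open in $\underline{X}_i$. A partially ordered class is an $\alpha$-complete join-semilattice if every subset $P$ with $|P|<\alpha$ has a least upper bound. *)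

(* Defs.v *)
From HB Require Import structures.
From Corelib Require Import Relation_Definitions.
From mathcomp Require Import all_boot all_order all_algebra.
From mathcomp Require Import all_classical.
From mathcomp Require Import topology.

Set Implicit Arguments.
Unset Strict Implicit.
Unset Printing Implicit Defensive.

Local Open Scope classical_set_scope.

(* [papp] is only defined on the subtype of the domain; a partial function is
   not encoded as a total function because its codomain may be empty. *)
Record partial_fun (X Y : Type) := PartialFun {
  pdom : set X;
  papp :> pdom -> Y }.

Arguments papp {X Y} p _.

(* [pdom F] carries the subspace topology, which is the library's topology on
   [set_type (pdom F)]. *)
Definition pcontinuous (X Y : topologicalType) (F : partial_fun X Y) : Prop :=
  continuous (papp F).

Definition le2 (X1 Y1 X2 Y2 : topologicalType) (f : X1 -> Y1) (g : X2 -> Y2) :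
    Prop :=
  exists (F : partial_fun (X1 * Y2)%type Y1) (G : partial_fun X1 X2),
    [/\ pcontinuous F, pcontinuous G &
        forall x : X1, exists xG : x \in pdom G,
          let y := g (G (exist _ x xG)) in
          exists xyF : (x, y) \in pdom F, f x = F (exist _ (x, y) xyF)].

(* The library's [#<=] cannot compare subsets of [degree2 C] below: its sets are
   over types in a universe strictly below that of [topologicalType]. *)
Definition card_lt (T U : Type) : Prop :=
  (exists f : T -> U, injective f) /\ ~ (exists g : U -> T, injective g).

(* The cardinal alpha is represented by a type [A] of that cardinality, which
   may be empty or finite. Classically every type has a [choiceType] structure;
   taking [A] and [I] in [choiceType] puts them in one universe, and the
   library's coproduct topology on [{i : I & X i}] ([sigT_openP]) requires it
   of [I]. *)
Definition coproduct_closed (A : choiceType) (C : topologicalType -> Prop) : Prop :=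
  forall (I : choiceType) (X : I -> topologicalType),
    card_lt I A -> (forall i, C (X i)) -> C {i : I & X i}.

Record map_in (C : topologicalType -> Prop) := MapIn {
  map_dom : topologicalType;
  map_cod : topologicalType;
  map_fun :> map_dom -> map_cod;
  map_domP : C map_dom;
  map_codP : C map_cod }.

Definition equiv2 (C : topologicalType -> Prop) (f g : map_in C) : Prop :=
  le2 f g /\ le2 g f.

Record degree2 (C : topologicalType -> Prop) := Degree2 {
  degree_set : map_in C -> Prop;
  degree_setP : exists f, degree_set = equiv2 f }.

Definition degree_le (C : topologicalType -> Prop) (p q : degree2 C) : Prop :=
  exists f g : map_in C, [/\ degree_set p f, degree_set q g & le2 f g].

Definition least_upper_bound (T : Type) (R : T -> T -> Prop) (P : T -> Prop)
    (s : T) : Prop :=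
  (forall p, P p -> R p s) /\ (forall u, (forall p, P p -> R p u) -> R s u).

Definition complete_join_semilattice (A : choiceType) (T : Type)
    (R : T -> T -> Prop) : Prop :=
  Relation_Definitions.order T R /\
  forall P : T -> Prop,
    card_lt {p : T | P p} A -> exists s, least_upper_bound R P s.

(* Main.v *)
(** The join of a family [f_i : X_i -> Y_i] is the coproduct map
    [\coprod_i X_i -> \coprod_i Y_i].  It lies above each [f_i] by
    [G x = (i, x)] and [F (x, (i, y)) = y].  If each [f_i] reduces to [g]
    through [F_i] and [G_i], the coproduct map reduces to [g] through
    [G (i, x) = G_i x] and [F ((i, x), z) = (i, F_i (x, z))]; continuity can be
    checked on each summand.  Partial functions are handled through their
    graphs, which avoids manipulating proofs of membership in a domain. *)

Require Import Defs.
From mathcomp Require Import all_boot all_order all_algebra.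
From mathcomp Require Import all_classical.
From mathcomp Require Import topology.

Set Implicit Arguments.
Unset Strict Implicit.
Unset Printing Implicit Defensive.

Local Open Scope classical_set_scope.

Definition functional_rel (X Y : Type) (R : X -> Y -> Prop) : Prop :=
  forall x y y', R x y -> R x y' -> y = y'.

(* For a functional [R], this is continuity of the partial function with graph
   [R], for the subspace topology on its domain. *)
Definition rel_continuous (X Y : topologicalType) (R : X -> Y -> Prop) : Prop :=
  forall x y, R x y -> forall V, nbhs y V ->
    nbhs x [set x' | forall y', R x' y' -> V y'].

Definition pgraph (X Y : Type) (F : partial_fun X Y) (x : X) (y : Y) : Prop :=
  exists xF : x \in pdom F, F (exist _ x xF) = y.

(** The value is picked by choice among those related to the point; it is determined by [R] when [R]
    is functional. *)
Definition rel_pfun (X Y : Type) (R : X -> Y -> Prop) : partial_fun X Y :=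
  @PartialFun X Y [set x | exists y, R x y]
    (fun s => sval (cid (set_mem (svalP s)))).

Lemma pgraph_functional (X Y : Type) (F : partial_fun X Y) :
  functional_rel (pgraph F).
Proof.
move=> x y y' [xF <-] [xF' <-].
by rewrite (bool_irrelevance xF xF').
Qed.

(** Transfers neighbourhoods to the ambient space; quantifying over [xD] leaves points outside [D]
    unconstrained. *)
Lemma nbhs_set_type (X : topologicalType) (D : set X) (s : D) (U : set D) :
  nbhs s U <-> nbhs (val s) [set x | forall xD : x \in D, U (exist _ x xD)].
Proof.
split.
  case=> _ [[W oW <-] Ws WU].
  apply: filterS (open_nbhs_nbhs (conj oW Ws)) => x Wx xD.
  exact: WU.
rewrite nbhsE => -[W [oW Ws] WU].
exists (val @^-1` W); split => //; first by exists W.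
by case=> x xD Wx; apply: WU.
Qed.

Lemma pgraph_continuous (X Y : topologicalType) (F : partial_fun X Y) :
  pcontinuous F -> rel_continuous (pgraph F).
Proof.
move=> cF x _ [xF <-] V /cF /nbhs_set_type /=.
by apply: filterS => x' Vx' _ [xF' <-]; apply: Vx'.
Qed.

Lemma rel_pfunP (X Y : Type) (R : X -> Y -> Prop) s :
  R (val s) (rel_pfun R s).
Proof. exact: svalP (cid _). Qed.

(** [rel_continuous] controls every value related to a nearby point, in particular the chosen
    one. *)
Lemma rel_pfun_continuous (X Y : topologicalType) (R : X -> Y -> Prop) :
  rel_continuous R -> pcontinuous (rel_pfun R).
Proof.
move=> cR s V /(cR _ _ (rel_pfunP s)) nV; apply/nbhs_set_type.
by apply: filterS nV => x' Vx' xD; apply/Vx'/(rel_pfunP (exist _ x' xD)).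
Qed.

(** Lets reductions be built and composed as relations, without membership proofs. *)
Lemma le2_relP (X1 Y1 X2 Y2 : topologicalType) (f : X1 -> Y1) (g : X2 -> Y2) :
  le2 f g <->
  exists (F : X1 * Y2 -> Y1 -> Prop) (G : X1 -> X2 -> Prop),
    [/\ functional_rel F, rel_continuous F, functional_rel G, rel_continuous G &
        forall x, exists2 u, G x u & F (x, g u) (f x)].
Proof.
split=> [[F [G [cF cG fFG]]]|[F [G [funF cF funG cG fFG]]]].
  exists (pgraph F), (pgraph G); split;
    [exact: pgraph_functional|exact: pgraph_continuous
    |exact: pgraph_functional|exact: pgraph_continuous|].
  move=> x; have [xG [xyF ->]] := fFG x.
  by exists (G (exist _ x xG)); [exists xG|exists xyF].
exists (rel_pfun F), (rel_pfun G); split; [exact: rel_pfun_continuous..|].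
move=> x; have [u xu xuF] := fFG x.
have xG : x \in pdom (rel_pfun G) by apply/mem_set; exists u.
exists xG.
(* Functionality identifies the chosen value with the given witness [u]. *)
have <- : u = rel_pfun G (exist _ x xG) := funG _ _ _ xu (rel_pfunP _).
have xyF : (x, g u) \in pdom (rel_pfun F) by apply/mem_set; exists (f x).
by exists xyF; apply: funF xuF (rel_pfunP _).
Qed.

Lemma le2_refl (X Y : topologicalType) (f : X -> Y) : le2 f f.
Proof.
apply/le2_relP; exists (fun p y => p.2 = y), (fun x u => x = u); split.
- by move=> p y y' <- <-.
- move=> [x y] _ /= <- V nV; exists (setT, V).
    by split=> //; exact: filterT.
  by move=> [x' y'] /= [_ Vy'] _ <-.
- by move=> p y y' <- <-.
- by move=> x _ <- V; apply: filterS => x' Vx' _ <-.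
- by move=> x; exists x.
Qed.

(** Substitution gives f(x) = F(x, F'(G(x), h(G'(G(x))))), so the new pair is (x, z) -> F(x,
    F'(G(x), z)) and G' o G. *)
Lemma le2_trans (X1 Y1 X2 Y2 X3 Y3 : topologicalType)
    (f : X1 -> Y1) (g : X2 -> Y2) (h : X3 -> Y3) :
  le2 f g -> le2 g h -> le2 f h.
Proof.
move=> /le2_relP[F [G [funF cF funG cG fFG]]].
move=> /le2_relP[F' [G' [funF' cF' funG' cG' gFG]]].
apply/le2_relP.
exists (fun p y => exists u v, [/\ G p.1 u, F' (u, p.2) v & F (p.1, v) y]).
exists (fun x w => exists2 u, G x u & G' u w); split.
- move=> [x z] y y' [u [v [xu uv vy]]] [u' [v' [xu' uv' vy']]] /=.
  rewrite -(funG _ _ _ xu xu') in uv'.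
  rewrite -(funF' _ _ _ uv uv') in vy'.
  exact: funF vy vy'.
- move=> [x z] y [u [v [/= xu uv vy]]] V nV.
  have [[U1 V1] /= [nU1 nV1] UV1] := cF _ _ vy _ nV.
  have [[U2 W2] /= [nU2 nW2] UW2] := cF' _ _ uv _ nV1.
  (* [x'] must stay in [U1] for [F], while its image under [G] must fall in [U2] for [F']. *)
  exists (U1 `&` [set x' | forall u', G x' u' -> U2 u'], W2).
    by split=> //=; apply: filterI => //; apply: cG nU2.
  move=> [x' z'] /= [[U1x' U2x'] W2z'] y' [u' [v' [xu' uv' vy']]].
  apply: (UV1 (x', v')) vy'; split=> //=.
  by apply: (UW2 (u', z')) uv'; split=> //=; apply: U2x'.
- move=> x w w' [u xu uw] [u' xu' uw'].
  rewrite -(funG _ _ _ xu xu') in uw'.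
  exact: funG' uw uw'.
- move=> x w [u xu uw] V nV.
  apply: filterS (cG _ _ xu _ (cG' _ _ uw _ nV)) => x' Vx' w' [u' xu'].
  exact: Vx'.
- move=> x; have [u xu xuf] := fFG x; have [w uw uwg] := gFG u.
  by exists w; [exists u|exists u, (g u)].
Qed.

Section Coproduct.
Variables (I : choiceType) (X Y : I -> topologicalType).
Variable f : forall i, X i -> Y i.

Definition coprod_map (s : {i : I & X i}) : {i : I & Y i} :=
  existT Y (projT1 s) (f (projT2 s)).

Lemma existT_inj2 (Z : I -> topologicalType) i : injective (existT Z i).
Proof. by move=> x y; apply: (@eq_from_Tagged I Z i x). Qed.

Lemma le2_coprod_map i : le2 (@f i) coprod_map.
Proof.
apply/le2_relP.
(* [F] strips the index [i] and is undefined on the other summands. *)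
exists (fun p y => p.2 = existT Y i y), (fun x s => s = existT X i x); split.
- by move=> p y y' -> /existT_inj2.
- move=> [x s] y /= -> V nV.
  exists (setT, existT Y i @` V); first by split; [exact: filterT|exact: existT_nbhs].
  by move=> [x' s'] /= [_ [y' Vy' <-]] y'' /existT_inj2 <-.
- by move=> x s s' -> ->.
(* Neighbourhoods in the coproduct are, by definition, pulled back along the inclusion of the
   summand. *)
- move=> x _ -> V nV; have {}nV : nbhs x (existT X i @^-1` V) by exact: nV.
  by apply: filterS nV => x' Vx' _ ->.
- by move=> x; exists (existT X i x).
Qed.

Lemma coprod_map_le2 (X2 Y2 : topologicalType) (g : X2 -> Y2) :
  (forall i, le2 (@f i) g) -> le2 coprod_map g.
Proof.
move=> /(_ _)/le2_relP/cid H.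
pose F i := sval (H i).
have FP i : exists G : X i -> X2 -> Prop,
    [/\ functional_rel (F i), rel_continuous (F i), functional_rel G,
        rel_continuous G & forall x, exists2 u, G x u & F i (x, g u) (f x)].
  exact: svalP (H i).
pose G i := sval (cid (FP i)).
have FGP i : [/\ functional_rel (F i), rel_continuous (F i),
    functional_rel (G i), rel_continuous (G i) &
    forall x, exists2 u, G i x u & F i (x, g u) (f x)].
  exact: svalP (cid (FP i)).
apply/le2_relP.
exists (fun p t => exists2 y, F _ (projT2 p.1, p.2) y & t = existT Y _ y).
exists (fun s u => G _ (projT2 s) u); split.
- move=> [[i x] z] _ _ /= [y xy ->] [y' xy' ->].
  by have [funF _ _ _ _] := FGP i; rewrite (funF _ _ _ xy xy').
- move=> [[i x] z] _ /= [y xy ->] V nV.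
  have [_ cF _ _ _] := FGP i.
  have [[U W] /= [nU nW] UW] := cF _ _ xy _ nV.
  (* Summands are open, so this neighbourhood can stay inside summand [i], where only [F i]
     matters. *)
  exists (existT X i @` U, W); first by split=> //; apply: existT_nbhs.
  move=> [_ z'] /= [[x' Ux' <-] Wz'] _ /= [y' xy' ->].
  exact: (UW (x', z')) xy'.
- by move=> [i x] u u' /=; have [_ _ funG _ _] := FGP i; apply: funG.
- move=> [i x] u /= xu V nV; have [_ _ _ cG _] := FGP i.
  exact: cG xu _ nV.
- move=> [i x]; have [_ _ _ _ /(_ x)[u xu xuF]] := FGP i.
  by exists u => //; exists (f x).
Qed.

End Coproduct.

Section Degrees.
Variable C : topologicalType -> Prop.
Implicit Types (f g : map_in C) (p q : degree2 C).

Definition degree_of f : degree2 C :=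
  @Degree2 C (equiv2 f) (ex_intro _ f erefl).

(** By transitivity, the order on classes can be tested on any representatives. *)
Lemma degree_leP p q f g :
  degree_set p = equiv2 f -> degree_set q = equiv2 g ->
  degree_le p q <-> le2 f g.
Proof.
move=> pf qg; split=> [[f' [g' []]]|fg].
  rewrite pf qg => -[ff' _] [_ g'g] f'g'.
  exact: le2_trans ff' (le2_trans f'g' g'g).
exists f, g; rewrite pf qg.
by split=> //; split; apply: le2_refl.
Qed.

Lemma degree_le_order : Relation_Definitions.order (degree2 C) (@degree_le C).
Proof.
split.
- move=> p; have [f pf] := degree_setP p.
  exact/(degree_leP pf pf)/le2_refl.
- move=> p q r; have [f pf] := degree_setP p.
  have [g qg] := degree_setP q; have [h rh] := degree_setP r.
  move=> /(degree_leP pf qg) fg /(degree_leP qg rh) gh.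
  exact/(degree_leP pf rh)/(le2_trans fg gh).
- move=> p q; have [f pf] := degree_setP p; have [g qg] := degree_setP q.
  move=> /(degree_leP pf qg) fg /(degree_leP qg pf) gf.
  have fgE : equiv2 f = equiv2 g.
    apply/funext => h; apply/propext; split=> -[h1 h2].
      by split; [exact: le2_trans gf h1|exact: le2_trans h2 fg].
    by split; [exact: le2_trans fg h1|exact: le2_trans h2 gf].
  (* Degrees with the same underlying set are equal by proof irrelevance. *)
  case: p q pf qg => [P PP] [Q QQ] /= pf qg.
  have PQ : P = Q by rewrite pf qg.
  by case: Q / PQ QQ {qg} => QQ; rewrite (Prop_irrelevance PP QQ).
Qed.

End Degrees.

Theorem theorem4p5 (A : choiceType) (C : topologicalType -> Prop)
    (HC : coproduct_closed A C) :
  complete_join_semilattice A (@degree_le C).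
Proof.
split; first exact: degree_le_order.
move=> P [[e e_inj] notAP].
(* [{p | P p}] is too large to index a coproduct; its image in [A] is not. *)
pose I : choiceType := set_type [set a : A | exists p, e p = a].
(* [p_] inverts [e] on its image, and [f_] below chooses a representative of each class. *)
pose p_ (i : I) : {p | P p} := sval (cid (set_mem (svalP i))).
have e_p i : e (p_ i) = val i by exact: svalP (cid (set_mem (svalP i))).
pose f_ (i : I) : map_in C := sval (cid (degree_setP (sval (p_ i)))).
have f_P i : degree_set (sval (p_ i)) = equiv2 (f_ i).
  exact: svalP (cid (degree_setP (sval (p_ i)))).
have I_lt : card_lt I A.
  split; first by exists val; apply: val_inj.
  (* [p_] is injective, since [e] undoes it, so an injection of [A] into [I] would give one into
     [{p | P p}]. *)
  move=> [h h_inj]; apply: notAP; exists (p_ \o h) => a b /= ab.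
  by apply: h_inj; apply: val_inj; rewrite -!e_p ab.
pose s : map_in C := MapIn (coprod_map f_)
  (HC _ _ I_lt (fun i => map_domP (f_ i))) 
  (HC _ _ I_lt (fun i => map_codP (f_ i))).
exists (degree_of s); split=> [p Pp|u Pu].
  have iI : e (exist _ p Pp) \in [set a : A | exists p, e p = a].
    by apply/mem_set; exists (exist _ p Pp).
  pose i : I := SigSub iI.
  (* Injectivity of [e] shows that every member of [P] is among the joined classes. *)
  have pE : p = sval (p_ i) by rewrite (e_inj _ _ (e_p i)).
  have := f_P i; rewrite -pE => pf.
  by apply/(degree_leP pf (erefl : degree_set (degree_of s) = _))/le2_coprod_map.
have [g ug] := degree_setP u.
apply/(degree_leP (erefl : degree_set (degree_of s) = _) ug)/coprod_map_le2 => i.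
exact/(degree_leP (f_P i) ug)/Pu/(svalP (p_ i)).
Qed.
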